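(* Let $V$ be a finite sample space and let $P$ and $Q$ be probability mass functions on $V$. Working in the algebra $A=\mathbb{R}_{\bot,\log_2,\ltimes}$, the Shannon entropy $H(P)$ is given by the term $$H(P)=\sum_{x\in V}P(x)\ltimes\Big(\log_2\frac{1}{P(x)}\Big)$$ and, equivalently, by the term $$H(P)=-\sum_{x\in V}P(x)\ltimes\log_2 P(x).$$ The cross entropy is given by $$H(P,Q)=\sum_{x\in V}P(x)\ltimes\log_2\frac{1}{Q(x)}$$ and, equivalently, by $$H(P,Q)=-\sum_{x\in V}P(x)\ltimes\log_2 Q(x).$$
   Context: The algebra $\mathbb{R}_{\bot,\log_2,\ltimes}$ has domain $\mathbb{R}\cup\{\bot\}$ with $\bot\notin\mathbb{R}$, constants $0,1,\bot$, and total operations $x+y$, $-x$, $x\cdot y$, $\frac{x}{y}$, $\log_2(x)$, $x\ltimes y$. On real arguments the first five are the usual operations, except that $\frac{x}{0}=\bot$ for all $x$, and $\log_2(x)=\bot$ for real $x\le 0$; each of these five operations returns $\bot$ whenever one of its arguments is $\bot$. Left-sequential multiplication is $x\ltimes y=(x\cdot y)\lhd x\rhd 0$, where the conditional operator is $x\lhd y\rhd z=z$ if $y=0$; $=x$ if $y\ne 0$ and $y\neq\bot$; $=\bot$ if $y=\bot$. Thus $x\ltimes y=0$ if $x=0$ (even when $y=\bot$), and $x\ltimes y=x\cdot y$ if $x\ne 0$. A probability mass function on a finite set $V$ is a function $P:V\to\mathbb{R}$ with $P(x)\ge 0$ for all $x\in V$ and $\sum_{x\in V}P(x)=1$. Conventional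 meaning of the measures: Shannon entropy is $H(P)=-\sum_{x\in V,\,P(x)>0}P(x)\log_2 P(x)$ (the convention $0\cdot\log_2 0=0$). Cross entropy $H(P,Q)$ is $-\sum_{x\in V,\,P(x)>0}P(x)\log_2 Q(x)$ if $Q(x)>0$ for every $x$ with $P(x)>0$, and is $\bot$ (used in place of the customary $\infty$) if there is $x\in V$ with $P(x)>0$ and $Q(x)=0$. *)

(* Defs.v *)
From HB Require Import structures.
From mathcomp Require Import all_boot all_order all_algebra.
From mathcomp Require Import reals exp.

Set Implicit Arguments.
Unset Strict Implicit.
Unset Printing Implicit Defensive.

Import Order.TTheory GRing.Theory Num.Theory.

Local Open Scope ring_scope.

(* [ln] is the natural logarithm; it is total in the library (0 on
   nonpositive arguments), so [log2 x] is meaningful only for [0 < x]. *)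
Definition log2 {R : realType} (x : R) : R := ln x / ln 2.

(* The domain R + {bot}: [None] is bot and [Some r] is the real number r. *)
Definition alg (R : realType) : Type := option R.

Declare Scope alg_scope.
Delimit Scope alg_scope with alg.
Bind Scope alg_scope with alg.

Definition inj {R : realType} (r : R) : alg R := Some r.
Definition bot {R : realType} : alg R := None.

Definition aadd {R : realType} (x y : alg R) : alg R :=
  match x, y with
  | Some a, Some b => Some (a + b)
  | _, _ => None
  end.

Definition aopp {R : realType} (x : alg R) : alg R :=
  match x with
  | Some a => Some (- a)
  | None => None
  end.

Definition amul {R : realType} (x y : alg R) : alg R :=
  match x, y with
  | Some a, Some b => Some (a * b)
  | _, _ => None
  end.

Definition adiv {R : realType} (x y : alg R) : alg R :=
  match x, y with
  | Some a, Some b => if b == 0 then None else Some (a / b)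
  | _, _ => None
  end.

Definition alog2 {R : realType} (x : alg R) : alg R :=
  match x with
  | Some a => if 0 < a then Some (log2 a) else None
  | None => None
  end.

(* [acond x y z] is "x <| y |> z"; the condition is the middle argument. *)
Definition acond {R : realType} (x y z : alg R) : alg R :=
  match y with
  | Some b => if b == 0 then z else x
  | None => None
  end.

Definition altimes {R : realType} (x y : alg R) : alg R :=
  acond (amul x y) x (inj 0).

Notation "r %:alg" := (inj r) (at level 1, format "r %:alg") : ring_scope.
Notation "r %:alg" := (inj r) (at level 1, format "r %:alg") : alg_scope.
Notation "0" := (inj 0%R) : alg_scope.
Notation "1" := (inj 1%R) : alg_scope.
Notation "x + y" := (aadd x y) : alg_scope.
Notation "- x" := (aopp x) : alg_scope.
Notation "x * y" := (amul x y) : alg_scope.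
Notation "x / y" := (adiv x y) : alg_scope.
Notation "x \ltimes y" := (altimes x y)
  (at level 40, left associativity) : alg_scope.
Notation "\sum_ ( i : T ) F" := (\big[aadd/inj 0%R]_(i : T) F%alg) : alg_scope.

(* Addition is a commutative monoid, so sums over a finite type do not depend
   on the enumeration order. *)
Section AddMonoid.
Variable R : realType.

Lemma aaddA : associative (@aadd R).
Proof. by move=> [a|] [b|] [c|] //=; rewrite addrA. Qed.

Lemma aaddC : commutative (@aadd R).
Proof. by move=> [a|] [b|] //=; rewrite addrC. Qed.

Lemma add0a : left_id (inj 0) (@aadd R).
Proof. by move=> [a|] //=; rewrite add0r. Qed.

HB.instance Definition _ :=
  Monoid.isComLaw.Build (alg R) (inj 0) (@aadd R) aaddA aaddC add0a.

End AddMonoid.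

Definition is_pmf {R : realType} {V : finType} (P : V -> R) : Prop :=
  (forall x, 0 <= P x) /\ \sum_(x : V) P x = 1.

Definition shannon_entropy {R : realType} {V : finType} (P : V -> R) : R :=
  - \sum_(x : V | 0 < P x) P x * log2 (P x).

(* The value is bot, in place of the customary infinity, unless Q is positive
   on the support of P. *)
Definition cross_entropy {R : realType} {V : finType} (P Q : V -> R) : alg R :=
  if [forall x : V, (0 < P x) ==> (0 < Q x)]
  then inj (- \sum_(x : V | 0 < P x) P x * log2 (Q x))
  else bot.

(* Main.v *)
(* Since [alog2 (1 / q) = - alog2 q] holds for every real [q], both sides being
   bot when [q <= 0], each formula with [1 / q] reduces to the one without. In
   the latter, [\ltimes] discards the terms where [P x = 0], and a single bot
   among the remaining terms makes the whole sum bot. Shannon entropy is the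
   case [Q = P]. *)
Require Import Defs.
From mathcomp Require Import all_boot all_order all_algebra.
From mathcomp Require Import reals exp.

Import Order.TTheory GRing.Theory Num.Theory.

Local Open Scope ring_scope.
Local Open Scope alg_scope.

Lemma log2V (R : realType) (x : R) : (0 < x -> log2 x^-1 = - log2 x)%R.
Proof. by move=> x_gt0; rewrite /log2 lnV ?posrE// mulNr. Qed.

Lemma alog2_div1 (R : realType) (q : R) :
  alog2 (1 / q%:alg) = - alog2 q%:alg.
Proof.
rewrite /=; case: eqVneq => [->|_] /=; first by rewrite ltxx.
by rewrite div1r invr_gt0; case: ifP => //= q_gt0; rewrite log2V.
Qed.

(** If [x] is 0, both sides are 0 even for [y = bot], since [- 0 = 0]; if [x] is bot, or is nonzero
    with [y] bot, both sides are bot, which negation fixes. *)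
Lemma altimesN (R : realType) (x y : alg R) : x \ltimes (- y) = - (x \ltimes y).
Proof.
case: x y => [a|] [b|] //; rewrite /altimes /=; case: ifP => _ //=;
  by rewrite ?oppr0 ?mulrN.
Qed.

Lemma inj_sum (R : realType) (V : finType) (F : V -> R) :
  (\sum_(x : V) F x)%R%:alg = \sum_(x : V) (F x)%:alg.
Proof. exact: (big_morph (@inj R)). Qed.

Lemma aopp_sum (R : realType) (V : finType) (F : V -> alg R) :
  - (\sum_(x : V) F x) = \sum_(x : V) - F x.
Proof.
apply: (big_morph (@aopp R)) => [[a|] [b|]|] //=; first by rewrite opprD.
by rewrite oppr0.
Qed.

Lemma aoppK (R : realType) : involutive (@aopp R).
Proof. by case=> [a|] //=; rewrite opprK. Qed.

Lemma sum_altimes_alog2 (R : realType) (V : finType) (P Q : V -> R) :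
  (forall x, 0 <= P x)%R ->
  \sum_(x : V) ((P x)%:alg \ltimes alog2 (Q x)%:alg) = - cross_entropy P Q.
Proof.
move=> P_ge0; rewrite /cross_entropy; case: ifPn => [/forallP suppPQ|].
  (* Extending the real sum by 0 outside the support of [P] lets the two sums be compared term by
     term. *)
  rewrite [RHS]/= opprK [in RHS]big_mkcond -[RHS]/(inj _) inj_sum.
  apply: eq_bigr => x _; rewrite /altimes /=.
  (* As [P x] is nonnegative, [0 < P x] becomes [P x != 0], the test on which [acond] branches. *)
  have := suppPQ x; rewrite lt0r P_ge0 andbT.
  by case: eqVneq => //= _ ->.
rewrite negb_forall => /existsP[x]; rewrite negb_imply => /andP[Px_gt0 /negbTE Qx].
by rewrite (bigD1 x) //= /altimes /= Qx (gt_eqF Px_gt0).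
Qed.

(** For [Q = P] the support condition is a tautology, so the bot branch is never taken. *)
Lemma cross_entropy_self (R : realType) (V : finType) (P : V -> R) :
  cross_entropy P P = (shannon_entropy P)%:alg.
Proof. by rewrite /cross_entropy; case: ifPn => // /forallP[] x; apply/implyP. Qed.

Theorem proposition3p1 (R : realType) (V : finType) (P Q : V -> R)
    (hP : is_pmf P) (hQ : is_pmf Q) :
  [/\ (shannon_entropy P)%:alg
        = \sum_(x : V) ((P x)%:alg \ltimes alog2 (1 / (P x)%:alg)),
      (shannon_entropy P)%:alg
        = - (\sum_(x : V) ((P x)%:alg \ltimes alog2 (P x)%:alg)),
      cross_entropy P Q
        = \sum_(x : V) ((P x)%:alg \ltimes alog2 (1 / (Q x)%:alg))
    & cross_entropy P Q
        = - (\sum_(x : V) ((P x)%:alg \ltimes alog2 (Q x)%:alg))].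
Proof.
have [P_ge0 _] := hP.
(* The second argument [S] stays general: [S = P] yields the two Shannon formulas and [S = Q] the
   two for cross entropy. *)
have ceE S : cross_entropy P S
    = - (\sum_(x : V) ((P x)%:alg \ltimes alog2 (S x)%:alg)).
  by rewrite sum_altimes_alog2 // aoppK.
have ceVE S : cross_entropy P S
    = \sum_(x : V) ((P x)%:alg \ltimes alog2 (1 / (S x)%:alg)).
  rewrite ceE aopp_sum; apply: eq_bigr => x _.
  by rewrite alog2_div1 altimesN.
by rewrite -cross_entropy_self; split.
Qed.
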